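(* Let $S$ be a densely defined symmetric operator with equal defect numbers in a Hilbert space $\mathfrak{H}$ which commutes with a non-trivial fundamental symmetry $J$, let $\{C_\alpha\}_{\alpha\in D}$ be the set of all $C$-symmetries of $S$, and let $\Upsilon$ be the set of $J$-self-adjoint extensions of $S$ which commute with every $C_\alpha$, $\alpha\in D$. Then for each $A\in\Upsilon$ there exists a boundary triplet $(\mathcal{H},\Gamma_0,\Gamma_1)$ for $S^*$ such that $\mathcal{D}(A)=\ker\Gamma_0$ and the formulas $$\mathcal{C}_\alpha\Gamma_0 f=\Gamma_0C_\alpha f,\qquad \mathcal{C}_\alpha\Gamma_1 f=\Gamma_1C_\alpha f,\qquad \forall\alpha\in D,\ \forall f\in\mathcal{D}(S^* )$$ correctly define (i.e. as well-defined operators) an operator family $\{\mathcal{C}_\alpha\}_{\alpha\in D}$ in $\mathcal{H}$. If $S$ is a simple symmetric operator, then the correspondence $C_\alpha\mapsto\mathcal{C}_\alpha$ established by these formulas is injective.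
   Context: $\mathfrak{H}$ is a Hilbert space with inner product $(\cdot,\cdot)$. A fundamental symmetry is a bounded operator $J$ with $J=J^*$, $J^2=I$; it is non-trivial if $J\neq\pm I$. For a bounded operator $C$ and an operator $A$, ''$A$ commutes with $C$'', written $[A,C]=0$, means $AC=CA$ (including equality of domains). The operator $S$ satisfies $[S,J]=0$. $\{C_\alpha\}_{\alpha\in D}$ denotes the set (indexed by a set $D$) of all bounded operators $C$ in $\mathfrak{H}$ with $C^2=I$, $JC>0$ (i.e. $JC$ is self-adjoint and $(JCx,x)>0$ for $x\ne0$) and $SC=CS$. Each such $C$ also commutes with $S^*$, so it maps $\mathcal{D}(S^* )$ into itself. An operator $A$ is $J$-self-adjoint if it is densely defined and $A^*J=JA$. $\Sigma_J$ is the set of $J$-self-adjoint extensions $A\supset S$, and $\Upsilon=\{A\in\Sigma_J : [A,C_\alpha]=0\ \ \forall\alpha\in D\}$. A boundary triplet for $S^*$ is a triplet $(\mathcal{H},\Gamma_0,\Gamma_1)$, where $\mathcal{H}$ is a Hilbert space and $\Gamma_0,\Gamma_1:\mathcal{D}(S^* )\to\mathcal{H}$ are linear, such that $(S^*x,y)-(x,S^*y)=(\Gamma_1x,\Gamma_0y)_{\mathcal{H}}-(\Gamma_0x,\Gamma_1y)_{\mathcal{H}}$ for all $x,y\in\mathcal{D}(S^* )$ and $(\Gamma_0,\Gamma_1):\mathcal{D}(S^* )\to\mathcal{H}\oplus\mathcal{H}$ is surjective. $S$ is simple if the closed linear span of $\bigcup_{\mu\in\mathbb{C}\setminus\mathbb{R}}\ker(S^*-\mu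 I)$ is $\mathfrak{H}$. *)

(* Defs.v *)
From HB Require Import structures.
From mathcomp Require Export all_boot all_order all_algebra.
From mathcomp Require Export complex.
From mathcomp Require Export all_classical all_reals all_analysis.

Set Implicit Arguments.
Unset Strict Implicit.
Unset Printing Implicit Defensive.

Import Order.TTheory GRing.Theory Num.Theory.
Export numFieldNormedType.Exports.

Local Open Scope classical_set_scope.
Local Open Scope ring_scope.

(* The inner product is linear in its first argument and conjugate-linear in
   the second one. *)
HB.mixin Record isHilbert (R : realType) (H : Type)
    & CompleteNormedModule R[i] H := {
  inner : {dot H for Num.conj} ;
  sqr_norm_inner : forall x : H, `|x| ^+ 2 = inner x x
}.

#[short(type="hilbertType")]
HB.structure Definition Hilbert (R : realType) :=
  {H of CompleteNormedModule R[i] H & isHilbert R H}.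

Notation "'[ x , y ]" := (inner x y) : ring_scope.

Section Linear.
Context {K : numFieldType} {U V : lmodType K}.

Definition linear_subspace (W : set U) : Prop :=
  W 0 /\ forall (a : K) (x y : U), W x -> W y -> W (a *: x + y).

Definition linear_span (X : set U) : set U := smallest linear_subspace X.

Definition linear_on (W : set U) (f : U -> V) : Prop :=
  forall (a : K) (x y : U), W x -> W y -> f (a *: x + y) = a *: f x + f y.

Definition ker_on (W : set U) (f : U -> V) : set U := [set x | W x /\ f x = 0].

End Linear.

(* An unbounded operator: the values of [app] outside [dom] are irrelevant, so
   operators are compared with [op_eq] and never with Leibniz equality. *)
Record operator (H : Type) := Operator {
  dom : set H ;
  app :> H -> H
}.

Section Operators.
Context {H : Type}.
Implicit Types A B : operator H.

Definition op_eq A B : Prop :=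
  dom A = dom B /\ forall x, dom A x -> A x = B x.

Definition extends A B : Prop :=
  dom B `<=` dom A /\ forall x, dom B x -> A x = B x.

Definition op_total (f : H -> H) : operator H := Operator setT f.

Definition op_comp A B : operator H :=
  Operator [set x | dom B x /\ dom A (B x)] (A \o B).

Definition commutes A (C : H -> H) : Prop :=
  op_eq (op_comp A (op_total C)) (op_comp (op_total C) A).

End Operators.

Section HilbertOperators.
Context {R : realType} {H : hilbertType R}.
Implicit Types (S T A : operator H) (J C : {linear H -> H}).

Definition linear_op T : Prop :=
  linear_subspace (dom T) /\ linear_on (dom T) T.

Definition densely_defined T : Prop := dense (dom T).

Definition symmetric_op T : Prop :=
  forall x y, dom T x -> dom T y -> '[T x, y] = '[x, T y].

(* The vector [z] below is unique only when [T] is densely defined. *)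
Definition adjoint T : operator H :=
  let adj y z := forall x, dom T x -> '[T x, y] = '[x, z] in
  Operator [set y | exists z, adj y z] (fun y => xget 0 [set z | adj y z]).

Definition selfadjoint T : Prop :=
  densely_defined T /\ op_eq T (adjoint T).

Definition positive_op T : Prop :=
  selfadjoint T /\ forall x, dom T x -> x != 0 -> 0 < '[T x, x].

Definition bounded_op (f : H -> H) : Prop :=
  exists M : R, forall x, `|f x| <= M%:C%C * `|x|.

Definition ker_sub T (mu : R[i]) : set H :=
  ker_on (dom T) (fun x => T x - mu *: x).

Definition orthonormal_basis (N B : set H) : Prop :=
  [/\ B `<=` N,
      forall x y, B x -> B y -> '[x, y] = (x == y)%:R
    & N `<=` closure (linear_span B)].

Definition same_hilbert_dim (N M : set H) : Prop :=
  exists B B' : set H,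
    [/\ orthonormal_basis N B, orthonormal_basis M B' & (B #= B')%card].

(* For a densely defined symmetric S, dim ker(S^* - mu) is constant on each of
   the two open half-planes; the defect numbers are its two values. *)
Definition equal_defect_numbers S : Prop :=
  same_hilbert_dim (ker_sub (adjoint S) 'i) (ker_sub (adjoint S) (- 'i)).

Definition simple_op S : Prop :=
  closure (linear_span (\bigcup_(mu in [set mu : R[i] | mu \isn't Num.real])
                   ker_sub (adjoint S) mu)) = [set: H].

Definition fundamental_symmetry J : Prop :=
  [/\ bounded_op J, op_eq (op_total J) (adjoint (op_total J))
    & forall x, J (J x) = x].

Definition nontrivial J : Prop :=
  ~ (forall x, J x = x) /\ ~ (forall x, J x = - x).

Definition C_symmetry S J C : Prop :=
  [/\ bounded_op C, forall x, C (C x) = x,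
      positive_op (op_total (J \o C)) & commutes S C].

Definition J_selfadjoint J A : Prop :=
  densely_defined A /\
  op_eq (op_comp (adjoint A) (op_total J)) (op_comp (op_total J) A).

Definition Sigma_J S J A : Prop :=
  [/\ linear_op A, extends A S & J_selfadjoint J A].

Definition Upsilon S J (D : Type) (C_ : D -> {linear H -> H}) A : Prop :=
  Sigma_J S J A /\ forall alpha, commutes A (C_ alpha).

Definition boundary_triplet S (G : hilbertType R) (Gamma0 Gamma1 : H -> G) :
    Prop :=
  let Sa := adjoint S in
  [/\ linear_on (dom Sa) Gamma0,
      linear_on (dom Sa) Gamma1,
      forall x y, dom Sa x -> dom Sa y ->
        '[Sa x, y] - '[x, Sa y] =
        '[Gamma1 x, Gamma0 y] - '[Gamma0 x, Gamma1 y]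
    & forall u v : G, exists x, [/\ dom Sa x, Gamma0 x = u & Gamma1 x = v]].

Definition induced_operator S (G : hilbertType R) (Gamma0 Gamma1 : H -> G)
    (C : H -> H) (c : G -> G) : Prop :=
  forall f, dom (adjoint S) f ->
    c (Gamma0 f) = Gamma0 (C f) /\ c (Gamma1 f) = Gamma1 (C f).

End HilbertOperators.

(* Main.v *)
(** J is itself a C-symmetry, so A commutes with J and is therefore
    self-adjoint in the Hilbert space sense.  Let N = ker (S^* - i).  As A - i
    is onto, every f in D(S^* ) is uniquely u + n with u in D(A) and n in N, and
      Gamma0 f = n,   Gamma1 f = P_N ((A + i) u) + i n
    is a boundary triplet with values in N.  The adjoint of C_alpha is
    J C_alpha J, which also commutes with S; hence C_alpha leaves N and its
    orthogonal complement invariant, commutes with the decomposition, and the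
    induced operator is the restriction of C_alpha to N. *)
From HB Require Import structures.
Require Import Defs.
From mathcomp Require Import ring lra.

Set Implicit Arguments.
Unset Strict Implicit.
Unset Printing Implicit Defensive.

Import Order.TTheory GRing.Theory Num.Theory.

Local Open Scope classical_set_scope.
Local Open Scope ring_scope.

(** * Inner product, Cauchy-Schwarz inequality and orthogonal complements *)

Section InnerProduct.
Context {R : realType} {H : hilbertType R}.
Implicit Types (x y z : H) (X W : set H).

Lemma innerC x y : '[x, y] = ('[y, x])^*.
Proof. by rewrite (hermC (inner : {dot H for Num.conj})) expr0 mul1r. Qed.

Lemma inner_eq0C x y : '[x, y] = 0 -> '[y, x] = 0.
Proof. by move=> xy0; rewrite innerC xy0 rmorph0. Qed.

Lemma innerDl x y z : '[x + y, z] = '[x, z] + '[y, z].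
Proof. exact: linearDl. Qed.

Lemma innerBl x y z : '[x - y, z] = '[x, z] - '[y, z].
Proof. exact: linearBl. Qed.

Lemma innerZl a x z : '[a *: x, z] = a * '[x, z].
Proof. exact: linearZl_LR. Qed.

Lemma innerDr x y z : '[x, y + z] = '[x, y] + '[x, z].
Proof. exact: linearD. Qed.

Lemma innerBr x y z : '[x, y - z] = '[x, y] - '[x, z].
Proof. exact: linearB. Qed.

Lemma innerZr a x z : '[x, a *: z] = a^* * '[x, z].
Proof. exact: linearZr_LR. Qed.

Lemma inner0l x : '[0, x] = 0.
Proof. exact: linear0l. Qed.

Lemma inner0r x : '[x, 0] = 0.
Proof. exact: linear0. Qed.

Lemma inner_self_eq0 x : '[x, x] = 0 -> x = 0.
Proof.
by move=> /eqP; rewrite (dnorm_eq0 (inner : {dot H for Num.conj})) => /eqP.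
Qed.

Lemma inner_gt0 x : x != 0 -> 0 < '[x, x].
Proof. exact: neq0_dnorm_gt0. Qed.

Lemma inner_ext x y : (forall z, '[z, x] = '[z, y]) -> x = y.
Proof.
move=> xy; apply/eqP; rewrite -subr_eq0; apply/eqP/inner_self_eq0.
by rewrite innerBr xy subrr.
Qed.

(** Pythagoras after removing from [x] its component along [y]. Nonnegativity of the left side is
    Cauchy-Schwarz; the exact value also measures the gain in the distance-minimizing argument. *)
Lemma inner_component x y : y != 0 ->
  `|x - ('[x, y] / '[y, y]) *: y| ^+ 2 = '[x, x] - `|'[x, y]| ^+ 2 / '[y, y].
Proof.
move=> y0; have yy0 : 0 < '[y, y] by exact: inner_gt0.
pose s := '[x, y]; pose q := '[y, y]; pose a := s / q.
have yx : '[y, x] = s^* by rewrite innerC.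
have aC : a^* = s^* / q by rewrite rmorphM fmorphV /= {2}[q]innerC.
rewrite sqr_norm_inner innerBl !innerBr !innerZl !innerZr yx aC normCK.
rewrite -/s -/q /a.
by field; rewrite gt_eqF.
Qed.

Lemma CauchySchwarz x y : `|'[x, y]| <= `|x| * `|y|.
Proof.
have [->|y0] := eqVneq y 0; first by rewrite inner0r normr0 mulr_ge0.
have : 0 <= `|x - ('[x, y] / '[y, y]) *: y| ^+ 2 by rewrite exprn_ge0.
rewrite inner_component // subr_ge0 ler_pdivrMr ?inner_gt0 // => sq.
by rewrite -(ler_pXn2r (n := 2)) ?nnegrE ?mulr_ge0// exprMn !sqr_norm_inner.
Qed.

Definition orthocomp X : set H := [set y | forall x, X x -> '[x, y] = 0].

Lemma orthocomp_linear X : linear_subspace (orthocomp X).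
Proof.
split=> [x _|a x y xX yX z Xz]; first exact: inner0r.
by rewrite innerDr innerZr xX // yX // mulr0 addr0.
Qed.

Lemma orthocomp_closed X : closed (orthocomp X).
Proof.
move=> y yX x Xx; apply/eqP; apply: contraT; rewrite -normr_gt0 => xy_gt0.
have x_gt0 : 0 < `|x|.
  rewrite normr_gt0; apply: contraTneq xy_gt0 => ->.
  by rewrite inner0l normr0 ltxx.
(* The radius [|'[x, y]| / |x|] is chosen so that a point [z] of the complement in this ball would
   give [|'[x, y]| = |'[x, y - z]| < |'[x, y]|]. *)
have [z [zX]] := yX _ (nbhsx_ballx y _ (divr_gt0 xy_gt0 x_gt0)).
rewrite -ball_normE /= ltr_pdivlMr // mulrC.
move=> /(le_lt_trans (CauchySchwarz _ _)).
by rewrite innerBr (zX x Xx) subr0 ltxx.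
Qed.

(** [X] lies in the closed set [orthocomp [set y]]; by density so does [y], which is thus orthogonal
    to itself. *)
Lemma dense_orthocomp X y : dense X -> orthocomp X y -> y = 0.
Proof.
move=> dX yX; apply: inner_self_eq0.
suff: orthocomp [set y] y by apply.
have := @orthocomp_closed [set y]; rewrite closure_id => ->.
move=> B By; have [z [Bz Xz]] : B^° `&` X !=set0.
  by apply: dX; [exists y|exact: open_interior].
exists z; split; last exact: interior_subset Bz.
by move=> _ ->; rewrite innerC yX // rmorph0.
Qed.

End InnerProduct.

(** * Closed subspaces as Hilbert spaces *)

Record closed_subspace (R : realType) (H : hilbertType R) := ClosedSubspace {
  subspace_set : set H;
  subspace_linear : linear_subspace subspace_set;
  subspace_closed : closed subspace_set
}.

Section SubspaceType.
Context {R : realType} {H : hilbertType R} (W : closed_subspace H).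

(** The boundary space must be a type with its own Hilbert structure, hence a subtype of [H] and not
    a set. Membership is the boolean [\in], as the subtype structure is built on a boolean
    predicate. *)
Record subspace_type := SubspaceElt {
  elt_val : H;
  _ : elt_val \in subspace_set W
}.

HB.instance Definition _ := [isSub for elt_val].
HB.instance Definition _ := [Choice of subspace_type by <:].

Lemma subspace_submod_closed : submod_closed (fun x => x \in subspace_set W).
Proof.
have [W0 WD] := subspace_linear W; split; first exact/mem_set.
by move=> a x y /set_mem Wx /set_mem Wy; exact/mem_set/WD.
Qed.

HB.instance Definition _ :=
  GRing.SubChoice_isSubLmodule.Build R[i] H _ subspace_type
    subspace_submod_closed.

Implicit Types x y : subspace_type.

Lemma subspace_valP x : subspace_set W (val x).
Proof. exact/set_mem/valP. Qed.

Lemma subspace_ler_normD x y : `|val (x + y)| <= `|val x| + `|val y|.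
Proof. by rewrite raddfD ler_normD. Qed.

Lemma subspace_normrZ (a : R[i]) x : `|val (a *: x)| = `|a| * `|val x|.
Proof. by rewrite linearZ normrZ. Qed.

Lemma subspace_normr0_eq0 x : `|val x| = 0 -> x = 0.
Proof. by move/eqP; rewrite normr_eq0 => /eqP x0; exact/val_inj. Qed.

HB.instance Definition _ :=
  Lmodule_isNormed.Build R[i] subspace_type
    subspace_ler_normD subspace_normrZ subspace_normr0_eq0.

(** [val] preserves distances, so the image filter is Cauchy in [H]; its limit stays in [W] because
    [W] is closed. *)
Lemma subspace_complete (F : set_system subspace_type) :
  ProperFilter F -> cauchy F -> cvg F.
Proof.
move=> FF Fc.
have vF : cvg (val @ F : set_system H).
  apply: cauchy_cvg; apply/cauchy_ballP => e e0.
  have /cauchy_ballP /(_ e e0) := Fc.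
  case=> -[A B] /= [FA FB] AB; exists (val @` A, val @` B) => /=.
    by split; [apply: filterS FA|apply: filterS FB] => x Ax; exists x.
  move=> [_ _] /= [[x Ax <-] [y By <-]].
  have /= := AB (x, y) (conj Ax By).
  by rewrite -!ball_normE /= -[val x - val y](raddfB val).
have /cvg_ex[l Fl] := vF.
have Wl : l \in subspace_set W.
  apply/mem_set; apply: (closed_cvg _ (@subspace_closed _ _ W) _ _ Fl).
  by apply: nearW => x; exact: subspace_valP.
apply/cvg_ex; exists (SubspaceElt Wl).
apply/cvgrPdist_lt => e e0.
by have /cvgrPdist_lt /(_ e e0) := Fl; apply: filterS => x.
Qed.

HB.instance Definition _ :=
  Uniform_isComplete.Build subspace_type subspace_complete.

Definition subspace_inner x y : R[i] := '[val x, val y].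

Lemma subspace_bilinear :
  bilinear_for *%R (Num.conj \; *%R) subspace_inner.
Proof.
split=> [z a x y|z a x y]; rewrite /subspace_inner (linearP val).
  by rewrite innerDl innerZl.
by rewrite innerDr innerZr.
Qed.

HB.instance Definition _ :=
  bilinear_isBilinear.Build R[i] subspace_type subspace_type R[i]
    *%R (Num.conj \; *%R) subspace_inner subspace_bilinear.

Lemma subspace_hermitian x y :
  subspace_inner x y = (-1) ^+ false * (subspace_inner y x)^*.
Proof. by rewrite expr0 mul1r -innerC. Qed.

HB.instance Definition _ :=
  isHermitianSesquilinear.Build R[i] subspace_type false Num.conj
    subspace_inner subspace_hermitian.

Lemma subspace_inner_gt0 x : x != 0 -> 0 < subspace_inner x x.
Proof. by move=> x0; apply: inner_gt0. Qed.

HB.instance Definition _ :=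
  isDotProduct.Build R[i] subspace_type subspace_inner subspace_inner_gt0.

Lemma subspace_sqr_norm x : `|x| ^+ 2 = subspace_inner x x.
Proof. exact: sqr_norm_inner. Qed.

HB.instance Definition _ :=
  isHilbert.Build R subspace_type subspace_sqr_norm.

End SubspaceType.

(** * Orthogonal projection onto a closed subspace *)

Section Projection.
Context {R : realType} {H : hilbertType R}.
Implicit Types (x y z : H) (W : set H).

Local Notation "x %:C" := (real_complex R x) : ring_scope.

(** Norms take values in [R[i]]; a squared norm in [R] gives access to infima and to linear real
    arithmetic. *)
Definition sqnorm x : R := complex.Re (`|x| ^+ 2).

Lemma sqnormE x : `|x| ^+ 2 = (sqnorm x)%:C.
Proof. by rewrite RRe_real // realX // normr_real. Qed.

Lemma sqnorm_ge0 x : 0 <= sqnorm x.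
Proof. by rewrite -lecR -sqnormE exprn_ge0. Qed.

Lemma parallelogram x y :
  `|x - y| ^+ 2 = 2 * (`|x| ^+ 2 + `|y| ^+ 2) - `|x + y| ^+ 2.
Proof.
rewrite !sqr_norm_inner innerBl !innerBr innerDl !innerDr; ring.
Qed.

Lemma minimizing_sequence W x : W !=set0 ->
  exists d (u : nat -> H), [/\ forall n, W (u n),
    forall n, sqnorm (x - u n) < d + n.+1%:R^-1 &
    forall w, W w -> d <= sqnorm (x - w)].
Proof.
move=> [w0 Ww0]; pose E := [set sqnorm (x - w) | w in W].
have Einf : has_inf E.
  split; first by exists (sqnorm (x - w0)), w0.
  by exists 0 => _ [w _ <-]; exact: sqnorm_ge0.
have /choice[u uP] : forall n, exists w,
    W w /\ sqnorm (x - w) < inf E + n.+1%:R^-1.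
  move=> n; have [|_ [w Ww <-] lt_w] := @inf_adherent _ E n.+1%:R^-1 _ Einf.
    by rewrite invr_gt0.
  by exists w.
exists (inf E), u; split=> [n|n|w Ww]; [by case: (uP n)|by case: (uP n)|].
by apply: ge_inf; [case: Einf|exists w].
Qed.

Lemma norm_lt_sqnorm (r : R) x : 0 < r -> sqnorm x < r ^+ 2 -> `|x| < r%:C.
Proof.
move=> r0 xr; rewrite -(ltr_pXn2r (n := 2)) // ?nnegrE ?ler0c ?(ltW r0) //.
by rewrite sqnormE -rmorphXn ltcR.

Qed.

Lemma gt0_complexP (e : R[i]) : 0 < e -> exists2 r : R, 0 < r & e = r%:C.
Proof.
move=> e0; have /complex_realP[r er] := gtr0_real e0.
by exists r; rewrite // -ltcR -er.
Qed.

(* The parallelogram law at the midpoint of two terms of the sequence. *)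
Lemma minimizing_cauchy W x (d : R) (u : nat -> H) : linear_subspace W ->
  (forall n, W (u n)) -> (forall n, sqnorm (x - u n) < d + n.+1%:R^-1) ->
  (forall w, W w -> d <= sqnorm (x - w)) -> cauchy (u @ \oo).
Proof.
move=> [W0 WD] Wu ud dW; apply/cauchy_exP => _ /gt0_complexP[r r0 ->].
(* Since the midpoint lies in [W], the squared distance of two terms is at most 2(2d + 1/(n+1) +
   1/(N+1)) - 4d <= 4/(N+1), hence the 4. *)
have r2 : 0 < r ^+ 2 / 4 by rewrite divr_gt0 ?exprn_gt0.
have [N _ /(_ N (leqnn N)) /= Nr] := near_infty_natSinv_lt (PosNum r2).
exists (u N); exists N => // n /= Nn.
rewrite -ball_normE /=; apply: norm_lt_sqnorm => //.
have nN : n.+1%:R^-1 <= N.+1%:R^-1 :> R by rewrite lef_pV2 ?posrE ?ler_nat.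
pose m := 2^-1 *: (u N + u n).
have Wm : W m.
  have := WD 2^-1 _ _ (WD 1 _ _ (Wu N) (Wu n)) W0.
  by rewrite scale1r addr0.
have uE : u N - u n = (x - u n) - (x - u N).
  by rewrite opprB [RHS]addrC addrA subrK.
have mE : (x - u n) + (x - u N) = 2 *: (x - m).
  rewrite scalerBr scalerA divff ?pnatr_eq0// scale1r scaler_nat mulr2n.
  by rewrite addrACA -opprD [u n + _]addrC.
have : (sqnorm (u N - u n))%:C = (2 * (sqnorm (x - u n) + sqnorm (x - u N))
    - 4 * sqnorm (x - m))%:C.
  rewrite rmorphB !rmorphM (rmorphD _ (sqnorm _)) /= -!sqnormE.
  rewrite uE parallelogram mE normrZ.
  by rewrite exprMn ger0_norm // -natrX !rmorph_nat.
move=> /complexI ->; move: (ud n) (ud N) (dW m Wm) nN Nr => /=.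
set a := sqnorm _; set b := sqnorm _; set c := sqnorm _.
set p := n.+1%:R^-1; set q := N.+1%:R^-1.
move: (r ^+ 2) r2 => s s0; clearbody a b c p q; lra.
Qed.

(** Cauchy-Schwarz gives the continuity. The ascription [R[i]^o] views the scalars as a normed
    module over themselves. *)
Lemma inner_cvgl (T : Type) (F : set_system T) {FF : Filter F}
    (u : T -> H) l y :
  u @ F --> l -> ('[u n, y] : R[i]^o) @[n --> F] --> ('[l, y] : R[i]^o).
Proof.
move=> ul; apply/cvgrPdist_lt => e e0.
have [->|y0] := eqVneq y 0.
  by near=> n; rewrite !inner0r subrr normr0.
have y_gt0 : 0 < `|y| by rewrite normr_gt0.
have /cvgrPdist_lt /(_ _ (divr_gt0 e0 y_gt0)) := ul; apply: filterS => n.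
rewrite ltr_pdivlMr // => /(le_lt_trans (CauchySchwarz _ _)).
by rewrite innerBl.
Unshelve. all: by end_near.
Qed.

(** Near-minimizers are nearly orthogonal to [W]: moving from [w] to [w + a *: v] with the best [a]
    lowers the squared distance by [|'[x - w, v]| ^+ 2 / '[v, v]], and this drop cannot exceed
    [e]. *)
Lemma inner_minimizer W x w v (d e : R) : linear_subspace W ->
  (forall w, W w -> d <= sqnorm (x - w)) ->
  W w -> W v -> sqnorm (x - w) < d + e ->
  `|'[x - w, v]| ^+ 2 <= (e * sqnorm v)%:C.
Proof.
move=> [W0 WD] dW Ww Wv wde.
have e0 : 0 < e by have := dW w Ww; lra.
have [->|v0] := eqVneq v 0.
  by rewrite inner0r normr0 expr0n ler0c mulr_ge0 ?sqnorm_ge0 // ltW.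
have vv_gt0 : 0 < '[v, v] by exact: inner_gt0.
set z := x - w; pose a := '[z, v] / '[v, v].
have : (d)%:C <= `|z - a *: v| ^+ 2.
  rewrite sqnormE lecR /z -addrA -opprD dW // addrC.
  by have := WD a v w Wv Ww.
rewrite inner_component // lerBrDr -lerBrDl ler_pdivrMr // => /le_trans; apply.
rewrite -!sqr_norm_inner !sqnormE -rmorphB -rmorphM lecR.
by rewrite ler_wpM2r ?sqnorm_ge0 // lerBlDl ltW.
Qed.

(** A minimizing sequence is Cauchy, and its near-orthogonality to [W] becomes exact in the limit.
    Closedness is stated with sequences because the range of [A - mu] is shown closed in that
    form. *)
Lemma orthogonal_projection W : linear_subspace W ->
  (forall (u : nat -> H) l, (forall n, W (u n)) -> u @ \oo --> l -> W l) ->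
  forall x, exists2 p, W p & orthocomp W (x - p).
Proof.
move=> Wlin Wclosed x; have [W0 _] := Wlin.
have [d [u [Wu ud dW]]] := @minimizing_sequence W x (ex_intro _ 0 W0).
have /cauchy_cvg/cvg_ex[p up] := minimizing_cauchy Wlin Wu ud dW.
exists p; first exact: Wclosed up.
move=> v Wv; apply: inner_eq0C.
have lim_xp : ('[x - u n, v] : R[i]^o) @[n --> \oo] --> ('[x - p, v] : R[i]^o).
  by apply: inner_cvgl; apply: cvgB => //; exact: cvg_cst.
have lim0 : ('[x - u n, v] : R[i]^o) @[n --> \oo] --> (0 : R[i]^o).
  apply/cvgr0Pnorm_lt => _ /gt0_complexP[r r0 ->].
  (* The added 1 keeps the denominator positive when [v = 0]. *)
  have v1_gt0 : 0 < sqnorm v + 1 by rewrite ltr_wpDl ?sqnorm_ge0.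
  have r2 : 0 < r ^+ 2 / (sqnorm v + 1) by rewrite divr_gt0 ?exprn_gt0.
  near=> n.
  rewrite -(ltr_pXn2r (n := 2)) // ?nnegrE ?ler0c ?(ltW r0) //.
  apply: le_lt_trans (inner_minimizer Wlin dW (Wu n) Wv (ud n)) _.
  rewrite -rmorphXn ltcR.
  have : n.+1%:R^-1 < r ^+ 2 / (sqnorm v + 1).
    by near: n; exact: (near_infty_natSinv_lt (PosNum r2)).
  rewrite ltr_pdivlMr //; apply: le_lt_trans.
  by rewrite ler_wpM2l ?invr_ge0 // lerDl.
exact: (cvg_unique (@norm_hausdorff _ R[i]^o) lim_xp lim0).
Unshelve. all: by end_near.
Qed.

Lemma projection_exists (W : closed_subspace H) x :
  exists p : subspace_type W, orthocomp (subspace_set W) (x - val p).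
Proof.
have [u l Wu ul|p Wp xp] :=
    @orthogonal_projection (subspace_set W) (subspace_linear W) _ x.
  apply: (closed_cvg _ (@subspace_closed _ _ W) _ _ ul).
  exact: nearW.
by exists (SubspaceElt (mem_set Wp)).
Qed.

Definition proj (W : closed_subspace H) x : subspace_type W :=
  projT1 (cid (projection_exists W x)).

Lemma projP (W : closed_subspace H) x :
  orthocomp (subspace_set W) (x - val (proj W x)).
Proof. exact: projT2 (cid (projection_exists W x)). Qed.

(** Two candidates differ by a vector of [W] that is also a difference of vectors orthogonal to [W],
    hence orthogonal to itself. *)
Lemma proj_eq (W : closed_subspace H) x (p : subspace_type W) :
  orthocomp (subspace_set W) (x - val p) -> proj W x = p.
Proof.
move=> xp; apply/eqP; rewrite -subr_eq0; apply/eqP.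
apply: (@inner_self_eq0 _ (subspace_type W)).
have Wd := subspace_valP (proj W x - p).
have -> : '[proj W x - p, proj W x - p] =
    '[val (proj W x - p), val (proj W x - p)].
  by [].
have {2}-> : val (proj W x - p) = (x - val p) - (x - val (proj W x)).
  by rewrite (raddfB val) opprB [RHS]addrC addrA subrK.
by rewrite innerBr (xp _ Wd) (projP x Wd) subrr.
Qed.

Lemma proj_is_linear (W : closed_subspace H) : linear (proj W).
Proof.
move=> a x y; apply: proj_eq; rewrite (linearP val).
rewrite opprD addrACA -scalerBr.
by apply: (orthocomp_linear _).2; exact: projP.
Qed.

HB.instance Definition _ (W : closed_subspace H) :=
  GRing.isLinear.Build R[i] H (subspace_type W) *:%R
    (proj W) (proj_is_linear W).

End Projection.

(** * Restriction of an operator to an invariant closed subspace *)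

Section Restriction.
Context {R : realType} {H : hilbertType R} (W : closed_subspace H).
Variables (f : {linear H -> H}).
Hypothesis fW : forall x, subspace_set W x -> subspace_set W (f x).

Definition restriction (x : subspace_type W) : subspace_type W :=
  SubspaceElt (mem_set (fW (subspace_valP x))).

Lemma restriction_is_linear : linear restriction.
Proof. by move=> a x y; apply: val_inj; rewrite /= !linearP. Qed.

HB.instance Definition _ :=
  GRing.isLinear.Build R[i] (subspace_type W) (subspace_type W) *:%R
    restriction restriction_is_linear.

(** [g] is the adjoint of [f]; its invariance on [W] means that [f] preserves the orthogonal
    complement, so [f (x - proj W x)] stays orthogonal to [W]. *)
Lemma proj_commute (g : H -> H) x :
  (forall x y, '[g x, y] = '[x, f y]) ->
  (forall x, subspace_set W x -> subspace_set W (g x)) ->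
  proj W (f x) = restriction (proj W x).
Proof.
move=> gf gW; apply: proj_eq => y Wy.
by rewrite /= -linearB -gf; exact: (projP x (gW _ Wy)).
Qed.

End Restriction.

(** * Adjoints, symmetric and self-adjoint operators *)

Section Adjoint.
Context {R : realType} {H : hilbertType R}.
Implicit Types (S A T : operator H) (C : {linear H -> H}) (x y z : H).

Lemma adjoint_inner T x y : dom (adjoint T) y -> dom T x ->
  '[T x, y] = '[x, adjoint T y].
Proof. by move=> Ty Tx; apply: (xgetPex 0 Ty). Qed.

(** Two candidates for the adjoint vector differ by a vector orthogonal to the dense domain, so the
    choice made by [xget] is forced. *)
Lemma adjoint_eq T y z : densely_defined T ->
  (forall x, dom T x -> '[T x, y] = '[x, z]) ->
  dom (adjoint T) y /\ adjoint T y = z.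
Proof.
move=> Td Tyz; have Ty : dom (adjoint T) y by exists z.
split=> //; apply/eqP; rewrite -subr_eq0; apply/eqP.
apply: (dense_orthocomp Td) => x Tx.
by rewrite innerBr -adjoint_inner // Tyz // subrr.
Qed.

Lemma adjoint_linear_op T : densely_defined T -> linear_op (adjoint T).
Proof.
move=> Td; have lin a x y : dom (adjoint T) x -> dom (adjoint T) y ->
    dom (adjoint T) (a *: x + y) /\
    adjoint T (a *: x + y) = a *: adjoint T x + adjoint T y.
  move=> Tx Ty; apply: adjoint_eq => // z Tz.
  by rewrite !innerDr !innerZr !adjoint_inner.
split; last by move=> a x y Tx Ty; have [] := lin a x y Tx Ty.
split; last by move=> a x y Tx Ty; have [] := lin a x y Tx Ty.
by exists 0 => x _; rewrite !inner0r.
Qed.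

Lemma selfadjoint_symmetric A : selfadjoint A -> symmetric_op A.
Proof.
move=> [_ [domA AE]] x y Ax Ay.
by rewrite adjoint_inner -?AE // -domA.
Qed.

Lemma selfadjoint_maximal A y z : selfadjoint A ->
  (forall x, dom A x -> '[A x, y] = '[x, z]) -> dom A y /\ A y = z.
Proof.
move=> [Ad [domA AE]] Ayz; have [] := adjoint_eq Ad Ayz.
by rewrite -domA => Ay Aadj; rewrite AE.
Qed.

Lemma extends_adjoint S A : densely_defined S -> symmetric_op A ->
  extends A S -> extends (adjoint S) A.
Proof.
move=> Sd Asym [SA AE].
have adj y : dom A y -> dom (adjoint S) y /\ adjoint S y = A y.
  by move=> Ay; apply: adjoint_eq => // x Sx; rewrite -AE // Asym //; exact: SA.
by split=> y Ay; have [] := adj y Ay.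
Qed.

(** Symmetry gives [mu * '[x, x] = mu^* * '[x, x]], so a nonzero [x] would make [mu] real. *)
Lemma symmetric_eigenvector A mu x : symmetric_op A -> dom A x ->
  mu \isn't Num.real -> A x = mu *: x -> x = 0.
Proof.
move=> Asym Ax nmu Axmu; apply: inner_self_eq0; apply/eqP.
apply: contraNT nmu => xx0; rewrite CrealE; apply/eqP.
by apply: (mulIf xx0); rewrite -innerZr -innerZl -Axmu Asym.
Qed.

Lemma imaginary_nonreal (mu : R[i]) : mu != 0 -> mu^* = - mu ->
  mu \isn't Num.real.
Proof.
by move=> mu0 muC; rewrite CrealE muC eq_sym -addr_eq0 -mulr2n mulrn_eq0.
Qed.

Lemma commutesE T C : commutes T C ->
  (forall x, dom T (C x) <-> dom T x) /\ forall x, dom T x -> T (C x) = C (T x).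
Proof.
move=> [domTC TC]; have domE x : dom T (C x) <-> dom T x.
  have := congr1 (fun X : set H => X x) domTC; rewrite /= => domE.
  split=> Tx; first by have [] : dom T x /\ True by rewrite -domE.
  by have [] : True /\ dom T (C x) by rewrite domE.
by split=> // x Tx; apply: (TC x); split=> //; apply/domE.
Qed.

(** With [C'] the adjoint of [C], ['[S x, C y] = '[C' (S x), y] = '[S (C' x), y] =
    '[C' x, adjoint S y] = '[x, C (adjoint S y)]]. *)
Lemma commutes_adjoint S (C C' : {linear H -> H}) : densely_defined S ->
  (forall x y, '[C' x, y] = '[x, C y]) -> commutes S C' ->
  forall y, dom (adjoint S) y ->
    dom (adjoint S) (C y) /\ adjoint S (C y) = C (adjoint S y).
Proof.
move=> Sd C'C /commutesE[domS SC'] y Sy; apply: adjoint_eq => // x Sx.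
by rewrite -!C'C -SC' // adjoint_inner //; apply/domS.
Qed.

Lemma total_selfadjoint (f : H -> H) :
  op_eq (op_total f) (adjoint (op_total f)) <->
  forall x y, '[f x, y] = '[x, f y].
Proof.
split=> [[domf fE] x y|fsym].
  by rewrite [f y](fE y I) -adjoint_inner // -domf.
have fadj y : dom (adjoint (op_total f)) y /\ adjoint (op_total f) y = f y.
  by apply: adjoint_eq => // O [x Ox] _; exists x.
split=> [|y _]; last by have [] := fadj y.
by apply/seteqP; split=> // y _; have [] := fadj y.
Qed.

(** The range of [A - mu] is closed, because [A - mu] is bounded below, and its orthogonal
    complement is trivial, because it would consist of eigenvectors for a nonreal eigenvalue. *)
Lemma range_surjective A mu : linear_op A -> selfadjoint A ->
  mu != 0 -> mu^* = - mu -> forall y, exists2 x, dom A x & A x - mu *: x = y.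
Proof.
move=> [[A0 AD] Alin] Asa mu0 muC y.
have Asym := selfadjoint_symmetric Asa.
pose W := [set A x - mu *: x | x in dom A].
have A00 : A 0 = 0.
  apply: (addrI (A 0)).
  by have := Alin 1 0 0 A0 A0; rewrite scaler0 scale1r !addr0 => <-.
have shift_lin a u v : dom A u -> dom A v ->
    A (a *: u + v) - mu *: (a *: u + v) =
    a *: (A u - mu *: u) + (A v - mu *: v).
  move=> Au Av; rewrite Alin // scalerDr opprD addrACA scalerBr !scalerA.
  by rewrite [a * mu]mulrC.
have Wlin : linear_subspace W.
  split; first by exists 0; rewrite // A00 scaler0 subrr.
  move=> a _ _ [u Au <-] [v Av <-]; exists (a *: u + v); first exact: AD.
  exact: shift_lin.
(* |(A - mu) u|^2 = |A u|^2 + |mu|^2 |u|^2 because mu is purely imaginary. *)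
have lower u : dom A u -> `|mu| * `|u| <= `|A u - mu *: u|.
  move=> Au; rewrite -(ler_pXn2r (n := 2)) ?nnegrE ?mulr_ge0 //.
  rewrite -normrZ !sqr_norm_inner innerBl !innerBr !innerZl !innerZr muC.
  rewrite (Asym u u Au Au).
  rewrite (_ : _ - _ = '[A u, A u] + mu * (- mu * '[u, u])); last by ring.
  by rewrite lerDr -sqr_norm_inner exprn_ge0.
have Wclosed (w : nat -> H) l : (forall n, W (w n)) -> w @ \oo --> l -> W l.
  move=> Ww wl.
  have /choice[u uP] : forall n, exists x, dom A x /\ A x - mu *: x = w n.
    by move=> n; have [x Ax xw] := Ww n; exists x.
  have mu_gt0 : 0 < `|mu| by rewrite normr_gt0.
  have /cauchy_cvg/cvg_ex[v uv] : cauchy (u @ \oo).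
    apply/cauchy_exP => e e0.
    (* Both [w N] and [w n] come within half of [|mu| * e] of [l]; the lower bound then cancels the
       factor [|mu|]. *)
    have e2 : 0 < `|mu| * e / 2 by rewrite divr_gt0 ?mulr_gt0.
    have /cvgrPdist_lt /(_ _ e2) [N _ Nw] := wl.
    exists (u N); exists N => // n /= Nn; rewrite -ball_normE /=.
    rewrite -(ltr_pM2l mu_gt0); have [[AuN wN] [Aun wn]] := (uP N, uP n).
    have [Auu shift_sub] : dom A (u N - u n) /\
        A (u N - u n) - mu *: (u N - u n) = w N - w n.
      rewrite [u N - u n]addrC -scaleN1r; split; first exact: AD.
      by rewrite shift_lin // wN wn scaleN1r addrC.
    apply: le_lt_trans (lower _ Auu) _; rewrite shift_sub.
    have -> : w N - w n = (l - w n) - (l - w N).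
      by rewrite opprB [RHS]addrC addrA subrK.
    apply: le_lt_trans (ler_normB _ _) _.
    by rewrite [ltRHS]splitr ltrD //; apply: Nw => /=.
  have Auv : A (u n) @[n --> \oo] --> l + mu *: v.
    have -> : (fun n => A (u n)) = (fun n => w n + mu *: u n).
      by apply/funext => n; have [_ <-] := uP n; rewrite subrK.
    by apply: cvgD => //; exact: cvgZr.
  (* [A] is closed: symmetry passes to the limit along [u], and maximality puts [v] in the
     domain. *)
  have [Av AvE] : dom A v /\ A v = l + mu *: v.
    apply: (selfadjoint_maximal Asa) => x Ax.
    have ux : ('[u n, A x] : R[i]^o) @[n --> \oo] --> ('[v, A x] : R[i]^o).
      exact: inner_cvgl.
    have Aux : ('[A (u n), x] : R[i]^o) @[n --> \oo] -->
        ('[l + mu *: v, x] : R[i]^o) by exact: inner_cvgl.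
    have uAE : (fun n => '[A (u n), x]) = (fun n => '[u n, A x]).
      by apply/funext => n; have [Aun _] := uP n; rewrite Asym.
    rewrite uAE in Aux.
    have vx := cvg_unique (@norm_hausdorff _ R[i]^o) ux Aux.
    by rewrite innerC vx -innerC.
  by exists v => //; rewrite AvE addrK.
have [p [u Au <-] yp] := orthogonal_projection Wlin Wclosed y.
suff yp0 : y - (A u - mu *: u) = 0.
  by exists u => //; apply/esym/eqP; rewrite -subr_eq0 yp0.
move: (y - _) yp => z zW {Wlin Wclosed}.
(* Orthogonality to the range says that the adjoint of [A] sends [z] to [mu^* *: z], and
   [mu^* = - mu]. *)
have [Az AzE] : dom A z /\ A z = (- mu) *: z.
  apply: (selfadjoint_maximal Asa) => x Ax.
  have := zW (A x - mu *: x) (ex_intro2 _ _ x Ax erefl).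
  rewrite innerBl innerZl innerZr => /eqP; rewrite subr_eq0 => /eqP ->.
  by rewrite rmorphN /= muC opprK.
apply: symmetric_eigenvector Asym Az _ AzE.
by rewrite imaginary_nonreal ?oppr_eq0 // rmorphN /= muC opprK.
Qed.
End Adjoint.

(** * The boundary triplet of a self-adjoint extension *)

Section BoundaryTriplet.
Context {R : realType} {H : hilbertType R} (S A : operator H).
Hypotheses (S_dense : densely_defined S) (A_linear : linear_op A).
Hypotheses (A_sa : selfadjoint A) (A_S : extends A S).

Local Notation Sa := (adjoint S).

Definition defect_range (mu : R[i]) : set H :=
  [set S x - mu^* *: x | x in dom S].

Lemma ker_sub_adjoint mu : ker_sub Sa mu = orthocomp (defect_range mu).
Proof.
apply/seteqP; split=> y.
  move=> [Sy /eqP]; rewrite subr_eq0 => /eqP SyE _ [x Sx <-].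
  by rewrite innerBl innerZl adjoint_inner // SyE innerZr subrr.
move=> yX; have [|Sy SyE] := @adjoint_eq _ _ S y (mu *: y) S_dense.
  move=> x Sx; have /eqP := yX _ (ex_intro2 _ _ x Sx erefl).
  by rewrite innerBl innerZl innerZr subr_eq0 => /eqP.
by split; rewrite ?SyE ?subrr.
Qed.

(** This is the eigenspace of [adjoint S] at ['i], written as an orthogonal complement so that
    linearity and closedness are immediate. *)
Definition defect_space : closed_subspace H :=
  ClosedSubspace (orthocomp_linear (defect_range 'i))
                 (orthocomp_closed (X := defect_range 'i)).

Local Notation N := (subspace_type defect_space).

Lemma defectP (x : H) :
  subspace_set defect_space x <-> dom Sa x /\ Sa x = 'i *: x.
Proof.
rewrite /= -ker_sub_adjoint; split=> [[Sx /eqP]|[Sx SxE]].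
  by rewrite subr_eq0 => /eqP.
by split; rewrite /= ?SxE ?subrr.
Qed.

Let A_sym : symmetric_op A := selfadjoint_symmetric A_sa.

Let Sa_A : extends Sa A := extends_adjoint S_dense A_sym A_S.

Lemma kernel_meets_trivially mu x : mu \isn't Num.real -> dom A x ->
  Sa x = mu *: x -> x = 0.
Proof.
move=> nmu Ax SxE; apply: (symmetric_eigenvector A_sym Ax nmu).
by rewrite -SxE; have [_ ->] := Sa_A.
Qed.

(** Solving [A u - 'i *: u = Sa x - 'i *: x] puts [x - u] in the defect space. The existential
    stands outside the implication so that choice yields total functions, with the default [(0, 0)]
    off the domain. *)
Lemma decomposition_exists x : exists un : H * N,
  dom Sa x -> dom A un.1 /\ x = un.1 + val un.2.
Proof.
have [Sx|nSx] := pselect (dom Sa x); last by exists (0, 0).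
have [u Au uE] := range_surjective A_linear A_sa (@neq0Ci R[i]) (@conjCi R[i])
  (Sa x - 'i *: x).
have [domSa SaE] := Sa_A; have [[_ SaD] Salin] := adjoint_linear_op S_dense.
have Su := domSa u Au.
have Nn : x - u \in subspace_set defect_space.
  apply/mem_set/defectP; rewrite addrC -scaleN1r; split; first exact: SaD.
  have AuE : A u = Sa x - 'i *: x + 'i *: u by rewrite -uE subrK.
  rewrite Salin // SaE // AuE !scaleN1r scalerDr scalerN opprD opprB.
  by rewrite addrAC subrK addrC.
exists (u, SubspaceElt Nn) => _; split=> //=; by rewrite addrC subrK.
Qed.

Definition regular_part x : H := (projT1 (cid (decomposition_exists x))).1.

Definition Gamma0 x : N := (projT1 (cid (decomposition_exists x))).2.

(** The projected term produces the cross terms of the Green identity. Two defect vectors [m], [n]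
    contribute [2 * 'i * '[m, n]] to it, and the summand ['i *: Gamma0 x] supplies half of this from
    each boundary pairing. *)
Definition Gamma1 x : N :=
  proj defect_space (A (regular_part x) + 'i *: regular_part x)
  + 'i *: Gamma0 x.

Lemma decomposition x : dom Sa x ->
  dom A (regular_part x) /\ x = regular_part x + val (Gamma0 x).
Proof. exact: projT2 (cid (decomposition_exists x)). Qed.

Lemma dom_decomposition u (n : N) : dom A u -> dom Sa (u + val n) /\
  Sa (u + val n) = A u + 'i *: val n.
Proof.
move=> Au; have [domSa SaE] := Sa_A.
have [[_ SaD] Salin] := adjoint_linear_op S_dense.
have [Sn <-] := (defectP _).1 (subspace_valP n); have Su := domSa u Au.
rewrite -[u]scale1r; split; first exact: SaD.
by rewrite Salin // SaE // !scale1r.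
Qed.

(** Two decompositions differ by a vector of [dom A] that is an eigenvector of [Sa] at ['i], hence
    zero. *)
Lemma decomposition_unique u (n : N) : dom A u ->
  regular_part (u + val n) = u /\ Gamma0 (u + val n) = n.
Proof.
move=> Au; have [Sx _] := dom_decomposition n Au.
have [Av vE] := decomposition Sx; set v := regular_part _ in Av vE *.
set m := Gamma0 _ in vE *.
have [[_ AD] _] := A_linear.
have mnE : val (n - m) = v - u.
  rewrite (raddfB val); apply/eqP; rewrite subr_eq addrAC eq_sym subr_eq.
  by rewrite -vE addrC.
have Avu : dom A (v - u) by rewrite addrC -scaleN1r; exact: AD.
have vu0 : v - u = 0.
  have i_nonreal := imaginary_nonreal (@neq0Ci R[i]) (@conjCi R[i]).
  apply: (kernel_meets_trivially i_nonreal Avu).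
  by rewrite -mnE; have [_] := (defectP _).1 (subspace_valP (n - m)).
split; first by apply/eqP; rewrite -subr_eq0 vu0.
apply/esym/eqP; rewrite -subr_eq0; apply/eqP/val_inj.
by rewrite mnE vu0.
Qed.

Lemma Gamma0E u (n : N) : dom A u -> Gamma0 (u + val n) = n.
Proof. by move=> Au; have [] := decomposition_unique n Au. Qed.

Lemma Gamma1E u (n : N) : dom A u ->
  Gamma1 (u + val n) = proj defect_space (A u + 'i *: u) + 'i *: n.
Proof.
by move=> Au; rewrite /Gamma1; have [-> ->] := decomposition_unique n Au.
Qed.

Lemma Gamma0_linear : linear_on (dom Sa) Gamma0.
Proof.
move=> a x y /decomposition[Au xE] /decomposition[Av yE].
have [[_ AD] _] := A_linear.
rewrite {1}xE {1}yE scalerDr addrACA -(linearP val).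
by rewrite Gamma0E //; exact: AD.
Qed.

Lemma Gamma1_linear : linear_on (dom Sa) Gamma1.
Proof.
move=> a x y /decomposition[Au xE] /decomposition[Av yE].
have [[_ AD] Alin] := A_linear.
rewrite {1}xE {1}yE scalerDr addrACA -(linearP val).
rewrite Gamma1E; last exact: AD.
rewrite Alin // /Gamma1.
move: (regular_part x) (regular_part y) (Gamma0 x) (Gamma0 y) => u v m n.
have -> : a *: A u + A v + 'i *: (a *: u + v) =
    a *: (A u + 'i *: u) + (A v + 'i *: v).
  by rewrite !scalerDr !scalerA [a * 'i]mulrC addrACA.
rewrite linearP !scalerDr !scalerA ['i * a]mulrC.
by rewrite addrACA.
Qed.

Lemma inner_projl (x : H) (n : N) : '[proj defect_space x, n] = '[x, val n].
Proof.
have : '[x - val (proj defect_space x), val n] = 0.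
  by apply: inner_eq0C; exact: (projP x (subspace_valP n)).
by rewrite innerBl => /eqP; rewrite subr_eq0 => /eqP ->.
Qed.

Lemma inner_projr (x : H) (n : N) : '[n, proj defect_space x] = '[val n, x].
Proof. by rewrite innerC inner_projl -innerC. Qed.

(** Symmetry of [A] cancels the terms in the two regular parts, and the projections disappear when
    paired with vectors of the defect space. *)
Lemma Gamma_Green x y : dom Sa x -> dom Sa y ->
  '[Sa x, y] - '[x, Sa y] = '[Gamma1 x, Gamma0 y] - '[Gamma0 x, Gamma1 y].
Proof.
move=> /decomposition[Au xE] /decomposition[Av yE].
rewrite {1 2}xE {1 2}yE /Gamma1; move: Au Av.
move: (regular_part x) (regular_part y) (Gamma0 x) (Gamma0 y) => u v m n Au Av.
have [_ ->] := dom_decomposition m Au; have [_ ->] := dom_decomposition n Av.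
rewrite [in RHS]innerDl [in RHS]innerDr inner_projl inner_projr.
rewrite !(innerDl, innerDr, innerZl, innerZr) (A_sym Au Av) conjCi.
ring.
Qed.

Lemma Gamma_surjective (a b : N) :
  exists x, [/\ dom Sa x, Gamma0 x = a & Gamma1 x = b].
Proof.
have ni0 : - 'i != 0 :> R[i] by rewrite oppr_eq0 neq0Ci.
have niC : (- 'i)^* = - - 'i :> R[i] by rewrite rmorphN /= conjCi.
(* Taking [mu = - 'i] solves [A u + 'i *: u = b - 'i *: a]; this right side is fixed by the
   projection, so [u + a] has the prescribed boundary values. *)
have [u Au uE] := range_surjective A_linear A_sa ni0 niC (val (b - 'i *: a)).
have [Sx _] := dom_decomposition a Au.
exists (u + val a); split; [by []|exact: Gamma0E|rewrite Gamma1E //].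
move: uE; rewrite scaleNr opprK => ->.
suff -> : proj defect_space (val (b - 'i *: a)) = b - 'i *: a by rewrite subrK.
by apply: proj_eq; rewrite subrr; exact: (orthocomp_linear _).1.
Qed.

Lemma dom_ker_Gamma0 : dom A = ker_on (dom Sa) Gamma0.
Proof.
apply/seteqP; split=> x.
  move=> Ax; have [Sx _] := dom_decomposition 0 Ax.
  by split; have := Gamma0E 0 Ax; rewrite raddf0 addr0 // in Sx *.
move=> [/decomposition[Au xE] x0].
by rewrite xE x0 raddf0 addr0.
Qed.

Lemma Gamma_boundary_triplet : boundary_triplet S Gamma0 Gamma1.
Proof.
split; [exact: Gamma0_linear|exact: Gamma1_linear|exact: Gamma_Green|].
exact: Gamma_surjective.
Qed.

(** * Operators induced on the boundary space, and injectivity *)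

Section Symmetry.
Variables (C C' : {linear H -> H}).
Hypotheses (C'C : forall x y, '[C' x, y] = '[x, C y]).
Hypotheses (S_C : commutes S C) (S_C' : commutes S C') (A_C : commutes A C).

Let CC' x y : '[C x, y] = '[x, C' y].
Proof. by rewrite innerC -C'C -innerC. Qed.

Lemma defect_space_stable x :
  subspace_set defect_space x -> subspace_set defect_space (C x).
Proof.
move=> /defectP[Sx SxE]; apply/defectP.
by have [SCx ->] := commutes_adjoint S_dense C'C S_C' Sx; rewrite SxE linearZ.
Qed.

(** The same argument with [C] and [C'] exchanged; it makes the complement of the defect space
    invariant under [C]. *)
Lemma defect_space_stable_adjoint x :
  subspace_set defect_space x -> subspace_set defect_space (C' x).
Proof.
move=> /defectP[Sx SxE]; apply/defectP.
by have [SCx ->] := commutes_adjoint S_dense CC' S_C Sx; rewrite SxE linearZ.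
Qed.

(** [C] maps [dom A] and the defect space into themselves, so it carries the decomposition of [x] to
    that of [C x]; it also commutes with the projection. *)
Lemma Gamma_induced :
  induced_operator S Gamma0 Gamma1 C (restriction defect_space_stable).
Proof.
move=> x /decomposition[Au xE]; rewrite {2 4}xE linearD.
have [domAC AC] := commutesE A_C.
have ACu : dom A (C (regular_part x)) by apply/domAC.
rewrite -[C (val _)]/(val (restriction defect_space_stable (Gamma0 x))).
rewrite Gamma0E // Gamma1E // AC // -linearZ -linearD.
rewrite (proj_commute defect_space_stable _ C'C defect_space_stable_adjoint).
by rewrite /Gamma1 linearD linearZ.
Qed.

End Symmetry.

(* On a decomposed eigenvector f = u + n of S^*, C1 f - C2 f = C1 u - C2 u lies
   both in D(A) and in an eigenspace of S^* with nonreal eigenvalue. *)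
Lemma symmetry_ext (C1 C2 C1' C2' : {linear H -> H}) : simple_op S ->
  (forall x y, '[C1' x, y] = '[x, C1 y]) ->
  (forall x y, '[C2' x, y] = '[x, C2 y]) ->
  commutes S C1' -> commutes S C2' -> commutes A C1 -> commutes A C2 ->
  (forall x, subspace_set defect_space x -> C1 x = C2 x) -> C1 =1 C2.
Proof.
move=> S_simple adj1 adj2 SC1 SC2 /commutesE[domC1 _] /commutesE[domC2 _] C12.
(* The set where [C1] and [C2] agree is the orthogonal complement of [Y], hence a closed subspace;
   by simplicity it is enough that it contains the eigenvectors. *)
pose Y := [set C1' y - C2' y | y in setT].
have YE x : orthocomp Y x <-> C1 x = C2 x.
  split=> [Yx|Cx _ [y _ <-]]; last by rewrite innerBl adj1 adj2 Cx subrr.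
  apply: inner_ext => y; apply/eqP; rewrite -subr_eq0 -adj1 -adj2 -innerBl.
  by apply/eqP/Yx; exists y.
suff eig mu x : mu \isn't Num.real -> ker_sub Sa mu x -> C1 x = C2 x.
  have spanY : closure (linear_span
      (\bigcup_(mu in [set mu : R[i] | mu \isn't Num.real]) ker_sub Sa mu))
      `<=` orthocomp Y.
    rewrite [X in _ `<=` X](closure_id _).1; last exact: orthocomp_closed.
    apply: closure_subset; apply: smallest_sub; first exact: orthocomp_linear.
    by move=> x [mu nmu xmu]; apply/YE; exact: eig nmu xmu.
  by move=> x; apply/YE/spanY; rewrite S_simple.
move=> nmu [Sx /eqP]; rewrite subr_eq0 => /eqP SxE.
have [[_ SaD] Salin] := adjoint_linear_op S_dense.
have [[_ AD] _] := A_linear.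
have [SC1x SC1E] := commutes_adjoint S_dense adj1 SC1 Sx.
have [SC2x SC2E] := commutes_adjoint S_dense adj2 SC2 Sx.
apply/eqP; rewrite -subr_eq0; apply/eqP.
apply: (kernel_meets_trivially nmu); last first.
  rewrite addrC -scaleN1r Salin // SC1E SC2E SxE !linearZ /= !scaleN1r.
  by rewrite scalerDr scalerN.
have [Au xE] := decomposition Sx.
have -> : C1 x - C2 x = C1 (regular_part x) - C2 (regular_part x).
  rewrite {1 2}xE !linearD /= (C12 _ (subspace_valP _)).
  by rewrite addrACA subrr addr0.
by rewrite addrC -scaleN1r; apply: AD; [apply/domC2|apply/domC1].
Qed.

End BoundaryTriplet.

(** * Fundamental symmetries and C-symmetries *)

Section Symmetries.
Context {R : realType} {H : hilbertType R} (S : operator H).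
Variable (J : {linear H -> H}).
Hypothesis J_fundamental : fundamental_symmetry J.

Lemma fundamental_symmetry_adjoint x y : '[J x, y] = '[x, J y].
Proof. by have [_ /total_selfadjoint] := J_fundamental. Qed.

Lemma fundamental_symmetryK x : J (J x) = x.
Proof. by have [] := J_fundamental. Qed.

(** For [C = J] the operator [J \o C] is the identity, which is positive. *)
Lemma fundamental_symmetry_C_symmetry : commutes S J -> C_symmetry S J J.
Proof.
have [Jb _ _] := J_fundamental => SJ.
split=> //; first exact: fundamental_symmetryK.
split; last by move=> x _ x0; rewrite /= fundamental_symmetryK inner_gt0.
split; last first.
  by apply/total_selfadjoint => x y /=; rewrite !fundamental_symmetryK.
by move=> O [x Ox] _; exists x.
Qed.

(** Self-adjointness of [J] and of [J \o C] gives J C = C* J, that is, C* = J C J. *)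
Lemma C_symmetry_adjoint (C : {linear H -> H}) : C_symmetry S J C ->
  forall x y, '[J (C (J x)), y] = '[x, C y].
Proof.
move=> [_ _ [[_ /total_selfadjoint JC] _] _] x y.
by rewrite [LHS]JC /= fundamental_symmetry_adjoint fundamental_symmetryK.
Qed.

Lemma commutes_comp (f g : {linear H -> H}) :
  commutes S f -> commutes S g -> commutes S (f \o g).
Proof.
move=> /commutesE[domf Sf] /commutesE[domg Sg]; split=> /=.
  apply/seteqP; split=> x /= [].
    by move=> _ /domf /domg.
  by move=> Sx _; split=> //; apply/domf/domg.
move=> x [_ /domf Sgx]; rewrite Sf // Sg //.
exact/domg.
Qed.

(** As [J] belongs to the family, A* J = J A = A J with equal domains; composing with [J] on the
    right gives A* = A. *)
Lemma Upsilon_selfadjoint (D : Type) (C_ : D -> {linear H -> H}) A alpha :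
  C_ alpha =1 J -> Upsilon S J C_ A -> selfadjoint A.
Proof.
move=> CJ [[_ _ [A_dense AJ]] /(_ alpha) AC].
have {}AC : commutes A J.
  by rewrite (_ : (J : H -> H) = C_ alpha) //; apply/funext => x; rewrite CJ.
have [domAJ JA] := commutesE AC.
split=> //; have adjA x : dom (adjoint A) (J x) <-> dom A x.
  have := congr1 (fun X : set H => X x) AJ.1; rewrite /= => domE.
  split=> Ax; first by have [] : dom A x /\ True by rewrite -domE.
  by have [] : True /\ dom (adjoint A) (J x) by rewrite domE.
split=> [|x Ax].
  apply/seteqP; split=> x; rewrite -[x]fundamental_symmetryK.
    by move=> /domAJ /adjA.
  by move=> /adjA AJx; apply/domAJ.
have Ay : dom A (J x) by apply/domAJ.
have /= := AJ.2 (J x); rewrite fundamental_symmetryK => ->.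
  by rewrite JA // fundamental_symmetryK.
by split=> //; rewrite -[x]fundamental_symmetryK; apply/adjA.
Qed.

End Symmetries.

Theorem lemma3p11 (R : realType) (H : hilbertType R) (S : operator H)
    (J : {linear H -> H}) (D : Type) (C_ : D -> {linear H -> H})
    (S_linear : linear_op S) (S_dense : densely_defined S)
    (S_symmetric : symmetric_op S) (S_defect : equal_defect_numbers S)
    (J_fundamental : fundamental_symmetry J) (J_nontrivial : nontrivial J)
    (S_J : commutes S J)
    (C_all : forall C : {linear H -> H},
       C_symmetry S J C <-> exists alpha, C_ alpha =1 C) :
  forall A : operator H, Upsilon S J C_ A ->
  exists (G : hilbertType R) (Gamma0 Gamma1 : H -> G),
    [/\ boundary_triplet S Gamma0 Gamma1,
        dom A = ker_on (dom (adjoint S)) Gamma0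
      & exists cC : D -> {linear G -> G},
          (forall alpha,
             induced_operator S Gamma0 Gamma1 (C_ alpha) (cC alpha) /\
             forall c : G -> G,
               induced_operator S Gamma0 Gamma1 (C_ alpha) c -> c =1 cC alpha) /\
          (simple_op S ->
             forall alpha beta, cC alpha =1 cC beta -> C_ alpha =1 C_ beta)].
Proof.
move=> A A_Upsilon.
have [alphaJ CJ] :=
  (C_all J).1 (fundamental_symmetry_C_symmetry J_fundamental S_J).
have A_sa := Upsilon_selfadjoint J_fundamental CJ A_Upsilon.
have [[A_linear A_S _] A_C] := A_Upsilon.
have symC alpha : C_symmetry S J (C_ alpha) by apply/C_all; exists alpha.
pose C' alpha : {linear H -> H} := J \o C_ alpha \o J.
have adjC alpha x y : '[C' alpha x, y] = '[x, C_ alpha y].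
  exact: C_symmetry_adjoint.
have S_C alpha : commutes S (C_ alpha) by have [] := symC alpha.
have S_C' alpha : commutes S (C' alpha).
  by apply: commutes_comp => //; apply: commutes_comp.
exists (subspace_type (defect_space S)).
exists (Gamma0 S_dense A_linear A_sa A_S), (Gamma1 S_dense A_linear A_sa A_S).
split; [exact: Gamma_boundary_triplet|exact: dom_ker_Gamma0|].
exists (fun alpha =>
  restriction (defect_space_stable S_dense (adjC alpha) (S_C' alpha))).
split=> [alpha|S_simple alpha beta ab].
  have ind := Gamma_induced S_dense A_linear A_sa A_S (adjC alpha) (S_C alpha)
    (S_C' alpha) (A_C alpha).
  split=> // c cind n.
  (* Every [n] is a value of [Gamma0], so the first formula alone determines [c]; the value 0 of
     [Gamma1] is arbitrary. *)
  have [x [Sx <- _]] := Gamma_surjective S_dense A_linear A_sa A_S n 0.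
  by rewrite (cind x Sx).1; exact: esym (ind x Sx).1.
(* Equal induced operators mean that the two symmetries agree on the defect space. *)
apply: (symmetry_ext S_dense A_linear A_sa A_S S_simple
  (adjC alpha) (adjC beta)) => // x Nx.
exact: (congr1 val (ab (SubspaceElt (mem_set Nx)))).
Qed.
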